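(* Consider the problem of finding $y_0>0$ and a function $\psi$ on $[0,y_0]$ such that $$-\psi'''+\tfrac14\,y\,\psi=0\ \text{ on }(0,y_0),\qquad \psi(0)=1,\quad \psi'(0)=0,\quad \psi(y_0)=\psi'(y_0)=0 .$$ This problem admits a countably infinite set of solutions (eigenfunctions) $\{\psi_0^{(k)}\}_{k\ge1}$, defined on the respective intervals $(0,y_0^{(k)})$, such that, as $k\to\infty$, $$y_0^{(k)}\sim k^{3/4}\to+\infty \quad\text{(i.e. } c_1k^{3/4}\le y_0^{(k)}\le c_2k^{3/4}\text{ for all large }k\text{, with some constants }0<c_1\le c_2),$$ and $$\psi_0^{(k)}(y)\to \frac{F(y)}{F(0)}\quad\text{uniformly on compact subsets of }[0,\infty).$$
   Context: The endpoint $y_0$ is an unknown playing the role of an eigenvalue: an eigenfunction is a function $\psi$ which, together with some $y_0>0$, solves the problem. The function $F$ is the rescaled kernel of the fundamental solution $b(x,t)=t^{-1/4}F(x/t^{1/4})$ of the one-dimensional bi-harmonic equation $u_t=-u_{xxxx}$; it is even and satisfies $$\mathbf{B}F\equiv -F^{(4)}+\tfrac14\,y\,F'+\tfrac14\,F=0\ \text{ in }\mathbb{R},\qquad \int_{\mathbb{R}}F\,dy=1 ,$$ i.e. $F$ is the first eigenfunction (with eigenvalue $0$) of the operator $\mathbf{B}$ on the whole line. *)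

(* Defs.v *)
From Stdlib Require Export Reals Rtopology.
From Coquelicot Require Export Coquelicot.
Open Scope R_scope.

(* [ex_derive_n f n y] only says that [Derive_n f (n - 1)], a total function,
   is differentiable at [y]; all lower orders have to be requested as well. *)
Definition differentiable_upto (n : nat) (f : R -> R) (y : R) : Prop :=
  forall j : nat, (j <= n)%nat -> ex_derive_n f j y.

Definition opB (F : R -> R) (y : R) : R :=
  - Derive_n F 4 y + / 4 * y * Derive F y + / 4 * F y.

(* [F] is the profile of the fundamental solution
   b(x,t) = t^(-1/4) F(x / t^(1/4)) of u_t = - u_xxxx.  These conditions
   determine it uniquely: by evenness BF = 0 integrates to F''' = y F / 4, and
   the even solutions of the latter form a plane, in which those with
   convergent integral form a line.
   The integral is the two-sided improper Riemann integral; absolute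
   convergence is not required. *)
Record biharmonic_profile (F : R -> R) : Prop := {
  profile_even : forall y : R, F (- y) = F y;
  profile_diff : forall y : R, differentiable_upto 4 F y;
  profile_eq : forall y : R, opB F y = 0;
  profile_mass :
    is_RInt_gen F (Rbar_locally m_infty) (Rbar_locally p_infty) 1
}.

(* [psi] stands for a function on [0, y0]; its values elsewhere play no role,
   and [D_in] makes the derivatives at the two endpoints one-sided. *)
Record eigenpair (y0 : R) (psi : R -> R) : Prop := {
  eigen_pos : 0 < y0;
  eigen_diff : forall y : R, 0 < y < y0 -> differentiable_upto 3 psi y;
  eigen_eq : forall y : R, 0 < y < y0 ->
    - Derive_n psi 3 y + / 4 * y * psi y = 0;
  eigen_left : psi 0 = 1;
  eigen_left' : D_in psi (fun _ : R => 0) (fun y : R => 0 <= y <= y0) 0;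
  eigen_right : psi y0 = 0;
  eigen_right' : D_in psi (fun _ : R => 0) (fun y : R => 0 <= y <= y0) y0
}.

(* [f k] is only meaningful on [0, a k], hence the requirement that the compact
   set eventually lie in that interval. *)
Definition cvg_unif_on_compacts
    (a : nat -> R) (f : nat -> R -> R) (g : R -> R) : Prop :=
  forall K : R -> Prop, compact K -> (forall y : R, K y -> 0 <= y) ->
  forall eps : R, 0 < eps ->
  eventually (fun k : nat =>
    forall y : R, K y -> y <= a k /\ Rabs (f k y - g y) < eps).

(* Main.v *)
Require Import Defs.
From Stdlib Require Import PeanoNat Wf_nat Lra Lia.

(** The equation [w''' = y w / 4] is invariant under [y -> - y], and its even
    solutions form the plane spanned by [u] and [v], where
    [(u, u', u'') = (1, 0, 0)] and [(v, v', v'') = (0, 0, 1)] at the origin.  The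
    conditions at the origin leave [u - l v] with [l] free, and this function has
    a double zero at [z > 0] exactly when [l = u(z) / v(z)] and the Wronskian
    [W = u v' - u' v] vanishes at [z].
    So the eigenpairs are parametrised by the positive zeros of [W].

    The function [W] solves the adjoint equation [W''' = - y W / 4], along which
    the energy [W W'' - W'^2 / 2] decreases; it equals [- 1 / 2] at the origin, so
    it stays negative.  Hence the zeros are simple.  They are also dense enough:
    where [W > 0] the second derivative of [sqrt W] is the energy divided by
    [2 W^(3/2)], which makes [sqrt W] concave, and a quantitative form of this
    bounds [a h^3] when [W] has no zero on [[a, a + h]] ([positive_stretch]).
    Conversely three zeros in [[a, c]] force zeros of [W'] and [W''], and
    integrating the equation three times gives [(c - a)^3 c >= 4]
    ([three_zeros]).  So [z_k^(4/3)] increases by at most a constant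
    at each step with [z_k >= 1], and by at least [1] every two steps, which is
    the law [z_k ~ k^(3/4)] ([zeros_growth]).

    For the limit, write the profile as [F = al u + be v]; evenness removes the
    odd solution.  With [w = u - l v] the [k]-th eigenfunction and [z = z_k],
    [F = al w + (be + al l) v] on [[0, z]].  The energy of [w] is [- l] at [0] and
    [0] at [z], and its derivative is [y w^2 / 4], so the eigenfunction has
    weighted square mass exactly [l].  Integrating [F] over [[z - 1, z]] then
    shows that [be + al l], multiplied by a quantity that grows like [z^2], stays
    bounded ([defect_bound]): the integral of [F] is bounded because the improper
    integral converges, that of [w] is controlled by [l], and that of [v] is at
    least [(z - 1)^2 / 2].  Thus [be + al l_k -> 0].  If [al = F 0] were zero, so
    would be [be] and [F]; hence [l_k -> - be / al] and
    [u - l_k v -> u + (be / al) v = F / F 0], uniformly where [v] is bounded. *)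

(** * Third-order solutions and their power series *)

(** The functions [w], [w1], [w2] stand for [w], [w'], [w''].  Carrying the
    derivatives explicitly keeps the Wronskian identities polynomial, so that
    [ring] proves them.  The sign [s] is [1] for the equation of the problem and
    [-1] for its adjoint. *)
Definition sol3 (s : R) (D : R -> Prop) (w w1 w2 : R -> R) : Prop :=
  forall y : R, D y ->
    is_derive w y (w1 y) /\ is_derive w1 y (w2 y) /\
    is_derive w2 y (s * (/ 4 * y * w y)).

Definition everywhere : R -> Prop := fun _ => True.

(** Taylor coefficients: the equation links the coefficients of [y^(n+4)] and
    [y^n], and that of [y^3] vanishes. *)
Fixpoint coef (c0 c1 c2 : R) (n : nat) : R :=
  match n with
  | 0%nat => c0
  | 1%nat => c1
  | 2%nat => c2
  | 3%nat => 0
  | S (S (S (S m))) =>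
      coef c0 c1 c2 m / (4 * (INR m + 4) * (INR m + 3) * (INR m + 2))
  end.

Lemma coef_step (c0 c1 c2 : R) (m : nat) :
  4 * (INR m + 4) * (INR m + 3) * (INR m + 2) * coef c0 c1 c2 (4 + m)
  = coef c0 c1 c2 m.
Proof.
  simpl.
  assert (H := pos_INR m). field. lra.
Qed.

Lemma nat_ind4 (P : nat -> Prop) :
  P 0%nat -> P 1%nat -> P 2%nat -> P 3%nat ->
  (forall m, P m -> P (4 + m)%nat) -> forall n, P n.
Proof.
  intros H0 H1 H2 H3 HS n.
  assert (H : P n /\ P (S n) /\ P (S (S n)) /\ P (S (S (S n)))).
  { induction n as [|n (Ha & Hb & Hc & Hd)]; [tauto|].
    repeat split; auto. exact (HS n Ha). }
  tauto.
Qed.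

Lemma coef_nonneg (c0 c1 c2 : R) :
  0 <= c0 -> 0 <= c1 -> 0 <= c2 -> forall n, 0 <= coef c0 c1 c2 n.
Proof.
  intros h0 h1 h2.
  apply nat_ind4; simpl; try lra.
  intros m Hm. assert (H := pos_INR m).
  apply Rmult_le_pos; [exact Hm|].
  apply Rlt_le, Rinv_0_lt_compat.
  repeat apply Rmult_lt_0_compat; lra.
Qed.

(** Once [m >= r^4], passing from the [m]-th to the [(m+4)]-th term divides by at
    least [1], so the terms stay below the maximum of finitely many of them. *)
Lemma coef_bounded (c0 c1 c2 r : R) :
  0 < r -> exists M, forall n, Rabs (coef c0 c1 c2 n * r ^ n) <= M.
Proof.
  intros Hr.
  set (b := fun n => Rabs (coef c0 c1 c2 n * r ^ n)).
  destruct (nfloor_ex (r ^ 4)) as [N HN]; [apply pow_le; lra|].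
  assert (Hfin : forall K, exists M, forall n, (n < K)%nat -> b n <= M).
  { induction K as [|K [M HM]].
    - exists 0. intros n Hn. lia.
    - exists (Rmax M (b K)). intros n Hn.
      destruct (Nat.eq_dec n K) as [->|Hne].
      + apply Rmax_r.
      + apply Rle_trans with M; [apply HM; lia | apply Rmax_l]. }
  destruct (Hfin (N + 5)%nat) as [M HM].
  exists M. change (forall n, b n <= M).
  intros n. induction n as [n IH] using lt_wf_ind.
  destruct (Nat.lt_ge_cases n (N + 5)) as [Hn|Hn]; [auto|].
  destruct (Nat.le_exists_sub 4 n) as [m [Hm _]]; [lia|].
  assert (Hnm : n = (4 + m)%nat) by lia.
  apply Rle_trans with (b m); [|apply IH; lia].
  assert (Hm0 : INR N + 1 <= INR m).
  { rewrite <- S_INR. apply le_INR. lia. }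
  assert (HN0 := pos_INR N).
  unfold b. rewrite Hnm, <- (coef_step c0 c1 c2 m), !Rabs_mult.
  rewrite (Rabs_pos_eq (r ^ _)), (Rabs_pos_eq (r ^ _)) by (apply pow_le; lra).
  rewrite !(Rabs_pos_eq (_ + _)) by lra. rewrite (Rabs_pos_eq 4) by lra.
  rewrite pow_add.
  assert (Hp : 0 <= Rabs (coef c0 c1 c2 (4 + m)) * r ^ m).
  { apply Rmult_le_pos; [apply Rabs_pos | apply pow_le; lra]. }
  assert (Hq : r ^ 4 <= 4 * (INR m + 4) * (INR m + 3) * (INR m + 2)).
  { apply Rle_trans with (INR m); [lra|]. nra. }
  nra.
Qed.

Lemma coef_radius (c0 c1 c2 x : R) :
  Rbar_lt (Rabs x) (CV_radius (coef c0 c1 c2)).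
Proof.
  destruct (CV_radius_bounded (coef c0 c1 c2)) as [Hub _].
  apply Rbar_lt_le_trans with (Rabs x + 1); [simpl; lra|].
  apply Hub, coef_bounded.
  assert (H := Rabs_pos x). lra.
Qed.

Lemma PSeries_nonneg (a : nat -> R) (x : R) :
  (forall n, 0 <= a n) -> 0 <= x -> ex_pseries a x -> 0 <= PSeries a x.
Proof.
  intros Ha Hx Hex.
  replace 0 with (0 * PSeries a x) by ring.
  unfold PSeries. rewrite <- Series_scal_l.
  apply Series_le.
  - intros n. assert (H : 0 <= a n * x ^ n) by (apply Rmult_le_pos; [auto | now apply pow_le]).
    lra.
  - eapply ex_series_ext; [|exact Hex].
    intros n. rewrite pow_n_pow. apply Rmult_comm.
Qed.

(** The last clause is the only quantitative fact used about the growing solution: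
    a power series with nonnegative coefficients dominates its quadratic term. *)
Lemma solution_exists (c0 c1 c2 : R) :
  exists w w1 w2 : R -> R,
    sol3 1 everywhere w w1 w2 /\
    w 0 = c0 /\ w1 0 = c1 /\ w2 0 = 2 * c2 /\
    (0 <= c0 -> 0 <= c1 -> 0 <= c2 -> forall y, 0 <= y -> c2 * y ^ 2 <= w y).
Proof.
  set (a := coef c0 c1 c2).
  exists (PSeries a), (PSeries (PS_derive a)), (PSeries (PS_derive (PS_derive a))).
  assert (Hr : forall x, Rbar_lt (Rabs x) (CV_radius a)) by apply coef_radius.
  split; [|split; [|split; [|split]]].
  - intros y _. split; [|split].
    + now apply is_derive_PSeries.
    + apply is_derive_PSeries. rewrite CV_radius_derive. auto.
    + replace (1 * (/ 4 * y * PSeries a y))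
        with (PSeries (PS_derive (PS_derive (PS_derive a))) y).
      { apply is_derive_PSeries. rewrite !CV_radius_derive. auto. }
      rewrite Rmult_1_l, Rmult_assoc, <- PSeries_incr_1, <- PSeries_scal.
      apply PSeries_ext. intros [|m].
      * unfold PS_derive, PS_scal, PS_incr_1. simpl. unfold scal, zero; simpl.
        unfold mult; simpl. change (a 3%nat) with 0. ring.
      * change (INR (2 + m) * (INR (3 + m) * (INR (4 + m) * coef c0 c1 c2 (4 + m)))
                = / 4 * coef c0 c1 c2 m).
        rewrite <- (coef_step c0 c1 c2 m), !plus_INR. simpl (INR 4). simpl (INR 3).
        simpl (INR 2). field.
  - apply PSeries_0.
  - rewrite PSeries_0. unfold PS_derive, a. simpl. ring.
  - rewrite PSeries_0. unfold PS_derive, a. simpl. ring.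
  - intros h0 h1 h2 y Hy.
    assert (Hn := coef_nonneg c0 c1 c2 h0 h1 h2). fold a in Hn.
    assert (He0 : ex_pseries a y) by now apply CV_radius_inside.
    assert (He1 : ex_pseries (PS_decr_1 a) y).
    { apply CV_radius_inside. rewrite CV_radius_decr_1. auto. }
    assert (He2 : ex_pseries (PS_decr_1 (PS_decr_1 a)) y).
    { apply CV_radius_inside. rewrite !CV_radius_decr_1. auto. }
    assert (He3 : ex_pseries (PS_decr_1 (PS_decr_1 (PS_decr_1 a))) y).
    { apply CV_radius_inside. rewrite !CV_radius_decr_1. auto. }
    rewrite PSeries_decr_1 by exact He0.
    rewrite PSeries_decr_1 by exact He1.
    rewrite PSeries_decr_1 by exact He2.
    assert (H3 : 0 <= PSeries (PS_decr_1 (PS_decr_1 (PS_decr_1 a))) y).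
    { apply PSeries_nonneg; auto. intros n. apply Hn. }
    unfold PS_decr_1 at 1 2 3. unfold a at 1 2 3. simpl coef.
    assert (0 <= y * c1) by now apply Rmult_le_pos.
    assert (0 <= y ^ 3 * PSeries (PS_decr_1 (PS_decr_1 (PS_decr_1 a))) y).
    { apply Rmult_le_pos; [now apply pow_le | exact H3]. }
    lra.
Qed.

(** * Wronskians and energy *)

Lemma derive_eq (f : R -> R) (x l l' : R) :
  is_derive f x l -> l = l' -> is_derive f x l'.
Proof. now intros H <-. Qed.

Lemma derive_add (f g : R -> R) (x l m : R) :
  is_derive f x l -> is_derive g x m -> is_derive (fun y => f y + g y) x (l + m).
Proof. exact (is_derive_plus f g x l m). Qed.

Lemma derive_sub (f g : R -> R) (x l m : R) :
  is_derive f x l -> is_derive g x m -> is_derive (fun y => f y - g y) x (l - m).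
Proof. exact (is_derive_minus f g x l m). Qed.

Lemma derive_mul (f g : R -> R) (x l m : R) :
  is_derive f x l -> is_derive g x m ->
  is_derive (fun y => f y * g y) x (l * g x + f x * m).
Proof. intros Hf Hg. exact (is_derive_mult f g x l m Hf Hg Rmult_comm). Qed.

Lemma derive_cst (c x : R) : is_derive (fun _ => c) x 0.
Proof. exact (is_derive_const c x). Qed.

Lemma derive_id (x : R) : is_derive (fun y => y) x 1.
Proof. exact (is_derive_id x). Qed.

Ltac derive_step :=
  lazymatch goal with
  | |- is_derive (fun y => _ + _) _ _ => eapply derive_add
  | |- is_derive (fun y => _ - _) _ _ => eapply derive_sub
  | |- is_derive (fun y => _ * _) _ _ => eapply derive_mul
  (* [fun y => c * y] reaches this point in eta-reduced form *)
  | |- is_derive (Rmult ?c) _ _ => eapply (derive_mul (fun _ => c) (fun y => y))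
  | |- is_derive (fun y => y) _ _ => apply derive_id
  | |- is_derive (fun y => ?c) _ _ => apply derive_cst
  | |- is_derive _ _ _ => eassumption
  end.

Ltac derive_poly := eapply derive_eq; [repeat derive_step | cbv beta; try ring].

Lemma sol3_restrict (s : R) (D E : R -> Prop) (w w1 w2 : R -> R) :
  (forall y, E y -> D y) -> sol3 s D w w1 w2 -> sol3 s E w w1 w2.
Proof. intros H Hw y Hy. exact (Hw y (H y Hy)). Qed.

Lemma sol3_sub_scal (s c : R) (D : R -> Prop) (w w1 w2 z z1 z2 : R -> R) :
  sol3 s D w w1 w2 -> sol3 s D z z1 z2 ->
  sol3 s D (fun y => w y - c * z y) (fun y => w1 y - c * z1 y)
    (fun y => w2 y - c * z2 y).
Proof.
  intros Hw Hz y Hy.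
  destruct (Hw y Hy) as (A0 & A1 & A2), (Hz y Hy) as (B0 & B1 & B2).
  split; [|split]; derive_poly.
Qed.

(** The 3 x 3 Wronskian determinant of [f], [g], [h], expanded. *)
Definition wr3 (f f1 f2 g g1 g2 h h1 h2 : R -> R) (y : R) : R :=
  f y * (g1 y * h2 y - g2 y * h1 y) - f1 y * (g y * h2 y - g2 y * h y)
  + f2 y * (g y * h1 y - g1 y * h y).

Definition convex (D : R -> Prop) : Prop :=
  forall x y z, D x -> D y -> x <= z <= y -> D z.

Lemma convex_interval (a b : R) : convex (fun y => a < y < b).
Proof. intros x y z Hx Hy Hz. lra. Qed.

Lemma const_of_derive0 (D : R -> Prop) (f : R -> R) :
  convex D -> (forall x, D x -> is_derive f x 0) ->
  forall x y, D x -> D y -> f x = f y.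
Proof.
  intros HD Hf.
  assert (H : forall x y, D x -> D y -> x < y -> f x = f y).
  { intros x y Hx Hy Hxy.
    apply (eq_is_derive f x y); [|exact Hxy].
    intros z Hz. apply Hf. now apply (HD x y). }
  intros x y Hx Hy.
  destruct (Rtotal_order x y) as [Hlt|[->|Hgt]]; auto. symmetry. auto.
Qed.

(** The coefficient of [w''] in the equation is zero, so by Liouville's formula
    the determinant does not vary. *)
Lemma wr3_const (D : R -> Prop) (f f1 f2 g g1 g2 h h1 h2 : R -> R) :
  convex D -> sol3 1 D f f1 f2 -> sol3 1 D g g1 g2 -> sol3 1 D h h1 h2 ->
  forall x y, D x -> D y ->
  wr3 f f1 f2 g g1 g2 h h1 h2 x = wr3 f f1 f2 g g1 g2 h h1 h2 y.
Proof.
  intros HD Hf Hg Hh. apply const_of_derive0; [exact HD|].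
  intros x Hx. unfold wr3.
  destruct (Hf x Hx) as (F0 & F1 & F2), (Hg x Hx) as (G0 & G1 & G2),
    (Hh x Hx) as (H0 & H1 & H2).
  derive_poly.
Qed.

Lemma wronskian_sol3 (D : R -> Prop) (u u1 u2 v v1 v2 : R -> R) :
  sol3 1 D u u1 u2 -> sol3 1 D v v1 v2 ->
  sol3 (-1) D (fun y => u y * v1 y - u1 y * v y)
    (fun y => u y * v2 y - u2 y * v y) (fun y => u1 y * v2 y - u2 y * v1 y).
Proof.
  intros Hu Hv y Hy.
  destruct (Hu y Hy) as (A0 & A1 & A2), (Hv y Hy) as (B0 & B1 & B2).
  split; [|split]; derive_poly.
Qed.

(** Along a solution of sign [s] its derivative is [s y w^2 / 4]: monotone on the
    half-line, increasing for the equation and decreasing for its adjoint. *)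
Definition energy (w w1 w2 : R -> R) (y : R) : R := w y * w2 y - / 2 * (w1 y * w1 y).

Lemma energy_derive (s : R) (D : R -> Prop) (w w1 w2 : R -> R) (y : R) :
  sol3 s D w w1 w2 -> D y ->
  is_derive (energy w w1 w2) y (s * (/ 4 * y * (w y * w y))).
Proof.
  intros Hw Hy. destruct (Hw y Hy) as (A0 & A1 & A2).
  unfold energy. derive_poly. field.
Qed.

(** * Spacing of the zeros of an adjoint solution *)

Lemma mean_value_strict (f f' : R -> R) (a b : R) :
  a < b -> (forall x, a <= x <= b -> is_derive f x (f' x)) ->
  exists c, a < c < b /\ f b - f a = f' c * (b - a).
Proof.
  intros Hab Hf.
  destruct (MVT_cor2 f f' a b Hab) as [c [Hc Hc']].
  - intros x Hx. apply is_derive_Reals. now apply Hf.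
  - now exists c.
Qed.

Lemma mean_value (f f' : R -> R) (a b : R) :
  a <= b -> (forall x, a <= x <= b -> is_derive f x (f' x)) ->
  exists c, a <= c <= b /\ f b - f a = f' c * (b - a).
Proof.
  intros [Hab|<-] Hf.
  - destruct (mean_value_strict f f' a b Hab Hf) as [c [Hc Ec]].
    exists c. split; [lra | exact Ec].
  - exists a. split; [lra | ring].
Qed.

Lemma concave_chord (f f1 f2 : R -> R) (a b x : R) :
  (forall y, a <= y <= b -> is_derive f y (f1 y)) ->
  (forall y, a <= y <= b -> is_derive f1 y (f2 y)) ->
  (forall y, a <= y <= b -> f2 y <= 0) ->
  a <= x <= b ->
  (b - x) * f a + (x - a) * f b <= (b - a) * f x.
Proof.
  intros H1 H2 Hneg Hx.
  destruct (mean_value f f1 a x) as [c [Hc Ec]];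
    [lra | intros; apply H1; lra |].
  destruct (mean_value f f1 x b) as [d [Hd Ed]];
    [lra | intros; apply H1; lra |].
  destruct (mean_value f1 f2 c d) as [e [He Ee]];
    [lra | intros; apply H2; lra |].
  assert (Hcd : f1 d <= f1 c).
  { assert (f2 e <= 0) by (apply Hneg; lra). nra. }
  assert (0 <= (x - a) * (b - x)) by (apply Rmult_le_pos; lra).
  nra.
Qed.

Lemma energy_decreasing (w w1 w2 : R -> R) (x y : R) :
  sol3 (-1) everywhere w w1 w2 -> 0 <= x <= y ->
  energy w w1 w2 y <= energy w w1 w2 x.
Proof.
  intros Hw Hxy.
  destruct (mean_value (energy w w1 w2)
    (fun y => -1 * (/ 4 * y * (w y * w y))) x y) as [c [Hc Ec]]; [lra| |].
  - intros z _. now apply (energy_derive (-1) everywhere).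
  - assert (0 <= c * (w c * w c)) by (apply Rmult_le_pos; [lra | nra]).
    assert (0 <= c * (w c * w c) * (y - x)) by (apply Rmult_le_pos; lra).
    nra.
Qed.

(** This identity is why the sign of the energy controls oscillation: [sqrt w] is
    concave where [w] is positive and the energy negative. *)
Lemma sqrt_second_derivative (w w1 w2 : R -> R) (y : R) :
  is_derive w y (w1 y) -> is_derive w1 y (w2 y) -> 0 < w y ->
  is_derive (fun y => w1 y * / (2 * sqrt (w y))) y
    (energy w w1 w2 y / (2 * sqrt (w y) ^ 3)).
Proof.
  intros H1 H2 Hpos.
  assert (Hs : 0 < sqrt (w y)) by now apply sqrt_lt_R0.
  eapply derive_eq.
  - apply derive_mul; [exact H2|].
    apply is_derive_inv; [|lra].
    apply derive_mul; [apply derive_cst|].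
    apply is_derive_sqrt; [exact H1 | exact Hpos].
  - unfold energy. cbv beta.
    assert (Hr : w y = sqrt (w y) * sqrt (w y)) by (rewrite sqrt_sqrt; lra).
    set (r := sqrt (w y)) in *. clearbody r. rewrite Hr. field. lra.
Qed.

(** Let [s = sqrt w], concave and positive, and [sg] its value at the midpoint
    [m].  Concavity gives [s >= sg / 2] on the quarter before [m], so the energy
    has dropped below [- a h sg^4 / 256] at [m]; it also gives [s <= 2 sg]
    everywhere, so on the second half [s'' <= - ka] with [ka = a h sg / 4096].  A
    positive function bounded by [2 sg] can only be that concave over a length
    [h / 2] if [ka h^2 <= 48 sg], that is [a h^3 <= 48 * 4096]. *)
Lemma positive_stretch (w w1 w2 : R -> R) (a h : R) :
  sol3 (-1) everywhere w w1 w2 -> 0 <= a -> 0 < h ->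
  energy w w1 w2 a <= 0 ->
  (forall y, a <= y <= a + h -> 0 < w y) ->
  a * h ^ 3 <= 262144.
Proof.
  intros Hw Ha Hh HE Hpos.
  set (s := fun y => sqrt (w y)).
  set (s1 := fun y => w1 y * / (2 * sqrt (w y))).
  set (s2 := fun y => energy w w1 w2 y / (2 * s y ^ 3)).
  assert (Hs : forall y, a <= y <= a + h -> 0 < s y).
  { intros y Hy. now apply sqrt_lt_R0, Hpos. }
  assert (Hss : forall y, a <= y <= a + h -> w y = s y * s y).
  { intros y Hy. symmetry. apply sqrt_sqrt. now apply Rlt_le, Hpos. }
  assert (D1 : forall y, a <= y <= a + h -> is_derive s y (s1 y)).
  { intros y Hy. destruct (Hw y I) as (A0 & _ & _).
    exact (is_derive_sqrt w y _ A0 (Hpos y Hy)). }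
  assert (D2 : forall y, a <= y <= a + h -> is_derive s1 y (s2 y)).
  { intros y Hy. destruct (Hw y I) as (A0 & A1 & _).
    now apply sqrt_second_derivative; auto. }
  assert (Hneg : forall y, a <= y <= a + h -> s2 y <= 0).
  { intros y Hy.
    assert (HEy : energy w w1 w2 y <= energy w w1 w2 a)
      by (apply energy_decreasing; [exact Hw | lra]).
    assert (0 < s y ^ 3) by now apply pow_lt, Hs.
    unfold s2, Rdiv. rewrite <- (Rmult_0_l (/ (2 * s y ^ 3))).
    apply Rmult_le_compat_r; [apply Rlt_le, Rinv_0_lt_compat; lra | lra]. }
  assert (chord : forall x y z, a <= x -> x <= z <= y -> y <= a + h ->
            (y - z) * s x + (z - x) * s y <= (y - x) * s z).
  { intros x y z Hx Hz Hy.
    apply (concave_chord s s1 s2 x y z); [ | | | exact Hz];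
      intros; [apply D1 | apply D2 | apply Hneg]; lra. }
  set (m := a + h / 2). set (sg := s m).
  assert (Hsg : 0 < sg) by (apply Hs; unfold m; lra).
  assert (Hup : forall y, a <= y <= a + h -> s y <= 2 * sg).
  { intros y Hy. assert (Hy0 := Hs y Hy).
    destruct (Rle_dec y m) as [Hym|Hym].
    - assert (C := chord y (a + h) m). fold sg in C.
      assert (H0 := Hs (a + h)).
      assert (0 <= (m - y) * s (a + h)) by (apply Rmult_le_pos; lra).
      unfold m in *. nra.
    - assert (C := chord a y m). fold sg in C.
      assert (H0 := Hs a).
      assert (0 <= (y - m) * s a) by (apply Rmult_le_pos; lra).
      unfold m in *. nra. }
  assert (Hlow : forall y, a + h / 4 <= y <= m -> sg / 2 <= s y).
  { intros y Hy. assert (C := chord a m y). fold sg in C.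
    assert (H0 := Hs a).
    assert (0 <= (m - y) * s a) by (unfold m in *; apply Rmult_le_pos; lra).
    unfold m in *. nra. }
  assert (HEm : energy w w1 w2 m <= - (a * h * sg ^ 4 / 256)).
  { destruct (mean_value (energy w w1 w2)
      (fun y => -1 * (/ 4 * y * (w y * w y))) (a + h / 4) m) as [c [Hc Ec]].
    - unfold m. lra.
    - intros z _. now apply (energy_derive (-1) everywhere).
    - assert (HE' : energy w w1 w2 (a + h / 4) <= energy w w1 w2 a)
        by (apply energy_decreasing; [exact Hw | lra]).
      assert (Hl := Hlow c Hc).
      assert (Hwc : sg ^ 2 / 4 <= w c).
      { rewrite Hss by (unfold m in *; lra). nra. }
      assert (Hwc2 : sg ^ 4 / 16 <= w c * w c) by nra.
      assert (0 < sg ^ 4) by now apply pow_lt.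
      assert (H1 : a * (sg ^ 4 / 16) <= c * (w c * w c)).
      { apply Rmult_le_compat; unfold m in *; lra. }
      replace (m - (a + h / 4)) with (h / 4) in Ec by (unfold m; field).
      assert (H2 : a * (sg ^ 4 / 16) * h <= c * (w c * w c) * h)
        by (apply Rmult_le_compat_r; lra).
      lra. }
  set (ka := a * h * sg / 4096).
  assert (Hka : forall y, m <= y <= a + h -> s2 y <= - ka).
  { intros y Hy.
    assert (Hy' : a <= y <= a + h) by (unfold m in *; lra).
    assert (HEy : energy w w1 w2 y <= energy w w1 w2 m)
      by (apply energy_decreasing; [exact Hw | unfold m in *; lra]).
    assert (H0 := Hs y Hy'). assert (H1 := Hup y Hy').
    assert (H3 : s y ^ 3 <= (2 * sg) ^ 3) by (apply pow_incr; lra).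
    assert (H4 : 0 < s y ^ 3) by now apply pow_lt.
    assert (H5 : 0 <= ka).
    { unfold ka. assert (0 <= a * h * sg); [|lra].
      repeat apply Rmult_le_pos; lra. }
    unfold s2. apply Rmult_le_reg_r with (2 * s y ^ 3); [lra|].
    unfold Rdiv. rewrite Rmult_assoc, Rinv_l, Rmult_1_r by lra.
    apply Rle_trans with (- ka * (2 * (2 * sg) ^ 3)); [|nra].
    replace (- ka * (2 * (2 * sg) ^ 3)) with (- (a * h * sg ^ 4 / 256))
      by (unfold ka; field).
    lra. }
  (* adding the parabola of second derivative [ka] leaves a concave function *)
  assert (C := concave_chord (fun y => s y + ka / 2 * ((y - m) * (y - m)))
     (fun y => s1 y + ka * (y - m)) (fun y => s2 y + ka)
     m (a + h) (m + h / 4)).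
  assert (Hb := Hs (a + h)).
  assert (Hx := Hup (m + h / 4)).
  fold sg in C.
  assert (C' : h / 4 * (sg + ka / 2 * ((m - m) * (m - m)))
      + h / 4 * (s (a + h) + ka / 2 * ((h / 2) * (h / 2)))
      <= h / 2 * (s (m + h / 4) + ka / 2 * ((h / 4) * (h / 4)))).
  { replace (a + h - (m + h / 4)) with (h / 4) in C by (unfold m; field).
    replace (m + h / 4 - m) with (h / 4) in C by ring.
    replace (a + h - m) with (h / 2) in C by (unfold m; field).
    apply C.
    - intros y Hy. assert (D := D1 y). derive_poly.
      + apply D. unfold m in *; lra.
      + field.
    - intros y Hy. assert (D := D2 y). derive_poly.
      + apply D. unfold m in *; lra.
      + field.
    - intros y Hy. assert (D := Hka y Hy). lra.
    - unfold m in *; lra. }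
  assert (Hfin : ka * h ^ 2 <= 48 * sg).
  { apply Rmult_le_reg_l with h; [exact Hh|].
    assert (s (m + h / 4) <= 2 * sg) by (apply Hx; unfold m; lra).
    assert (0 < s (a + h)) by (apply Hb; lra).
    assert (h * s (m + h / 4) <= h * (2 * sg)) by (apply Rmult_le_compat_l; lra).
    assert (0 < h * s (a + h)) by (apply Rmult_lt_0_compat; lra).
    lra. }
  unfold ka in Hfin.
  assert (H6 : sg * (a * h ^ 3) <= sg * (48 * 4096)) by lra.
  apply Rmult_le_reg_l in H6; lra.
Qed.

Lemma mean_value_bound (f f' : R -> R) (a b x z M : R) :
  (forall y, a <= y <= b -> is_derive f y (f' y)) ->
  (forall y, a <= y <= b -> Rabs (f' y) <= M) ->
  a <= x <= b -> a <= z <= b -> f z = 0 -> Rabs (f x) <= M * (b - a).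
Proof.
  intros Hf HM Hx Hz Zz.
  assert (HM0 : 0 <= M) by (apply Rle_trans with (Rabs (f' x)); auto using Rabs_pos).
  destruct (MVT_gen f z x f') as [c [Hc Ec]].
  - intros y Hy. apply Hf.
    revert Hy. unfold Rmin, Rmax. destruct (Rle_dec z x); lra.
  - intros y Hy. apply derivable_continuous_pt. exists (f' y).
    apply is_derive_Reals, Hf.
    revert Hy. unfold Rmin, Rmax. destruct (Rle_dec z x); lra.
  - replace (f x) with (f' c * (x - z)) by lra.
    rewrite Rabs_mult. apply Rmult_le_compat; try apply Rabs_pos.
    + apply HM. revert Hc. unfold Rmin, Rmax. destruct (Rle_dec z x); lra.
    + apply Rabs_le. lra.
Qed.

(** Rolle's theorem gives zeros of [w'] and [w''] between those of [w].  With [M]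
    the maximum of [|w|], three successive integrations of [|w'''| <= c M / 4] from
    these zeros bound [M] by [c M (c - a)^3 / 4].  Two zeros would not suffice,
    as nothing keeps two zeros of a third-order solution apart. *)
Lemma three_zeros (w w1 w2 : R -> R) (a b c : R) :
  sol3 (-1) everywhere w w1 w2 -> 0 <= a -> a < b < c ->
  w a = 0 -> w b = 0 -> w c = 0 ->
  (exists x, a <= x <= c /\ w x <> 0) ->
  4 <= (c - a) ^ 3 * c.
Proof.
  intros Hw Ha Hbc Za Zb Zc [x [Hx Hwx]].
  assert (D0 : forall y, is_derive w y (w1 y)) by (intros y; apply (Hw y I)).
  assert (D1 : forall y, is_derive w1 y (w2 y)) by (intros y; apply (Hw y I)).
  assert (D2 : forall y, is_derive w2 y (-1 * (/ 4 * y * w y)))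
    by (intros y; apply (Hw y I)).
  destruct (mean_value_strict w w1 a b) as [p [Hp Ep]]; [lra | auto |].
  destruct (mean_value_strict w w1 b c) as [q [Hq Eq]]; [lra | auto |].
  assert (Zp : w1 p = 0) by nra.
  assert (Zq : w1 q = 0) by nra.
  destruct (mean_value_strict w1 w2 p q) as [r [Hr Er]]; [lra | auto |].
  assert (Zr : w2 r = 0) by nra.
  destruct (continuity_ab_maj (fun y => Rabs (w y)) a c) as [m [Hmax Hm]]; [lra | |].
  { intros y _. apply (continuity_pt_comp w Rabs).
    - apply derivable_continuous_pt. exists (w1 y). now apply is_derive_Reals.
    - apply Rcontinuity_abs. }
  set (M := Rabs (w m)).
  assert (HM : 0 < M).
  { apply Rlt_le_trans with (Rabs (w x)); [now apply Rabs_pos_lt | now apply Hmax]. }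
  assert (B2 : forall y, a <= y <= c -> Rabs (w2 y) <= / 4 * c * M * (c - a)).
  { intros y Hy. apply (mean_value_bound w2 (fun y => -1 * (/ 4 * y * w y)) a c y r); auto; [|lra].
    intros z Hz. rewrite !Rabs_mult, Rabs_m1.
    rewrite (Rabs_pos_eq (/ 4)), (Rabs_pos_eq z) by lra.
    assert (Rabs (w z) <= M) by now apply Hmax.
    assert (z * Rabs (w z) <= c * M) by (apply Rmult_le_compat; auto using Rabs_pos; lra).
    lra. }
  assert (B1 : forall y, a <= y <= c -> Rabs (w1 y) <= / 4 * c * M * (c - a) * (c - a)).
  { intros y Hy. apply (mean_value_bound w1 w2 a c y p); auto; lra. }
  assert (B0 : M <= / 4 * c * M * (c - a) * (c - a) * (c - a)).
  { apply (mean_value_bound w w1 a c m a); auto; lra. }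
  apply Rmult_le_reg_l with M; [exact HM|]. lra.
Qed.

Lemma isolated_zero (f : R -> R) (a l : R) :
  is_derive f a l -> f a = 0 -> l <> 0 ->
  exists d, 0 < d /\ forall x, a < x < a + d -> f x <> 0.
Proof.
  intros Hf Za Hl. apply is_derive_Reals in Hf.
  destruct (Hf (Rabs l)) as [d Hd]; [now apply Rabs_pos_lt|].
  exists d. split; [apply cond_pos|].
  intros x Hx Zx.
  assert (H := Hd (x - a)).
  replace (a + (x - a)) with x in H by ring.
  rewrite Zx, Za in H.
  replace ((0 - 0) / (x - a) - l) with (- l) in H by (field; lra).
  rewrite Rabs_Ropp in H.
  apply (Rlt_irrefl (Rabs l)), H; [lra|].
  rewrite Rabs_pos_eq; lra.
Qed.

(** * Enumeration and growth of the zeros *)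

Definition oscillating (w w1 w2 : R -> R) : Prop :=
  sol3 (-1) everywhere w w1 w2 /\ w 0 = 0 /\ energy w w1 w2 0 < 0.

Lemma sol3_continuous (s : R) (w w1 w2 : R -> R) :
  sol3 s everywhere w w1 w2 -> continuity w.
Proof.
  intros Hw y. apply derivable_continuous_pt. exists (w1 y).
  apply is_derive_Reals. apply (Hw y I).
Qed.

Lemma sign_constant (f : R -> R) (a b : R) :
  continuity f -> 0 < f a -> (forall y, a <= y <= b -> f y <> 0) ->
  forall y, a <= y <= b -> 0 < f y.
Proof.
  intros Hc Ha Hnz y Hy.
  destruct (Rlt_le_dec 0 (f y)) as [H|H]; [exact H | exfalso].
  destruct (IVT_gen f a y 0 Hc) as [x [Hx Zx]].
  - rewrite Rmin_right, Rmax_left by lra. lra.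
  - rewrite Rmin_left, Rmax_right in Hx by lra. apply (Hnz x); lra.
Qed.

Lemma zero_in_long_interval (w w1 w2 : R -> R) (a h : R) :
  oscillating w w1 w2 -> 0 <= a -> 0 < h -> 262144 < a * h ^ 3 ->
  exists x, a <= x <= a + h /\ w x = 0.
Proof.
  intros (Hw & _ & HE) Ha Hh Hbig.
  apply Classical_Prop.NNPP. intros Hno.
  assert (Hnz : forall y, a <= y <= a + h -> w y <> 0).
  { intros y Hy Zy. apply Hno. now exists y. }
  assert (HEa : energy w w1 w2 a <= energy w w1 w2 0)
    by (apply energy_decreasing; [exact Hw | lra]).
  apply (Rlt_not_le _ _ Hbig).
  destruct (Rtotal_order (w a) 0) as [Hneg|[Hz|Hpos]].
  (* [w - 2 w] is [- w], in the form that [sol3_sub_scal] produces *)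
  - apply (positive_stretch (fun y => w y - 2 * w y) (fun y => w1 y - 2 * w1 y)
      (fun y => w2 y - 2 * w2 y) a h); auto.
    + now apply sol3_sub_scal.
    + unfold energy in *. lra.
    + intros y Hy.
      assert (0 < - w y); [|lra].
      apply (sign_constant (fun x => - w x) a (a + h)); auto.
      * apply (continuity_opp w), (sol3_continuous _ _ _ _ Hw).
      * lra.
      * intros x Hx. assert (H := Hnz x Hx). lra.
  - exfalso. apply (Hnz a); lra.
  - apply (positive_stretch w w1 w2 a h); auto; [lra|].
    apply sign_constant; auto. apply (sol3_continuous _ _ _ _ Hw).
Qed.

(** The endpoints may be zeros themselves, so [zero_in_long_interval] is applied
    to the middle half of the gap; halving the length costs a factor [8], and
    [8 * 262144 = 128^3]. *)
Lemma gap_above (w w1 w2 : R -> R) (a b : R) :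
  oscillating w w1 w2 -> 0 <= a < b -> (forall x, a < x < b -> w x <> 0) ->
  a * (b - a) ^ 3 <= 128 ^ 3.
Proof.
  intros Hw Hab Hnz.
  apply Rnot_lt_le. intros Hbig.
  destruct (zero_in_long_interval w w1 w2 (a + (b - a) / 4) ((b - a) / 2) Hw)
    as [x [Hx Zx]]; try lra.
  - assert (0 <= (b - a) * ((b - a) / 2) ^ 3).
    { apply Rmult_le_pos; [lra|]. apply pow_le; lra. }
    lra.
  - apply (Hnz x); [lra | exact Zx].
Qed.

(** An infimum needs no choice principle, whereas picking a zero for each [a]
    would. *)
Definition next_zero (w : R -> R) (a : R) : R :=
  real (Glb_Rbar (fun b => a < b /\ w b = 0)).

(** The infimum is finite because zeros exist beyond [a], lies strictly beyond [a]
    because the zero at [a] is simple, and is a zero by continuity. *)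
Lemma next_zero_spec (w w1 w2 : R -> R) (a : R) :
  oscillating w w1 w2 -> 0 <= a -> w a = 0 ->
  a < next_zero w a /\ w (next_zero w a) = 0 /\
  forall x, a < x < next_zero w a -> w x <> 0.
Proof.
  intros Hosc Ha Za.
  (* [65^3 > 262144 = 64^3], and the left end [a + 1] is at least [1] *)
  destruct (zero_in_long_interval w w1 w2 (a + 1) 65 Hosc) as [z [Hz Zz]]; try lra.
  destruct Hosc as (Hw & _ & HE).
  assert (HEa : energy w w1 w2 a <= energy w w1 w2 0)
    by (apply energy_decreasing; [exact Hw | lra]).
  destruct (isolated_zero w a (w1 a)) as [d [Hd Hnear]]; auto.
  { apply (Hw a I). }
  { intros H0. unfold energy in HEa at 1. rewrite Za, H0 in HEa. lra. }
  unfold next_zero.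
  destruct (Glb_Rbar_correct (fun b => a < b /\ w b = 0)) as [Hlb Hglb].
  destruct (Glb_Rbar (fun b => a < b /\ w b = 0)) as [g| |]; simpl.
  - assert (Hg : a + d <= g).
    { apply (Hglb (a + d)). intros b [Hb Zb]. simpl.
      apply Rnot_lt_le. intros Hlt. apply (Hnear b); [lra | exact Zb]. }
    assert (Hlow : forall b, a < b -> w b = 0 -> g <= b)
      by (intros b Hb Zb; apply (Hlb b); now split).
    split; [lra|]. split.
    + destruct (Req_dec (w g) 0) as [Zg|Ng]; [exact Zg | exfalso].
      destruct (sol3_continuous _ _ _ _ Hw g (Rabs (w g))) as [e [He Hclose]];
        [now apply Rabs_pos_lt|].
      assert (Habs : g + e <= g); [|lra].
      apply (Hglb (g + e)). intros b [Hb Zb]. simpl.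
      apply Rnot_lt_le. intros Hlt.
      assert (Hgb := Hlow b Hb Zb).
      assert (Hne : g <> b) by (intros ->; auto).
      specialize (Hclose b). simpl in Hclose. unfold R_dist in Hclose.
      rewrite Zb, Rminus_0_l, Rabs_Ropp in Hclose.
      apply (Rlt_irrefl (Rabs (w g))), Hclose.
      split; [split; [exact I | exact Hne]|].
      rewrite Rabs_pos_eq; lra.
    + intros x Hx Zx. assert (H := Hlow x). lra.
  - exfalso. apply (Hlb z). split; [lra | exact Zz].
  - exfalso. apply (Hglb (a + d)). intros b [Hb Zb]. simpl.
    apply Rnot_lt_le. intros Hlt. apply (Hnear b); [lra | exact Zb].
Qed.

(** The zero at the origin is the starting point; the positive zeros have index
    [1] and more. *)
Fixpoint zeros (w : R -> R) (k : nat) : R :=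
  match k with
  | O => 0
  | S k => next_zero w (zeros w k)
  end.

Lemma cube_le_reg (x y : R) : 0 <= y -> x ^ 3 <= y ^ 3 -> x <= y.
Proof.
  intros Hy H. apply Rnot_lt_le. intros Hlt.
  assert (0 < (x - y) * (x * x + x * y + y * y)); [|lra].
  apply Rmult_lt_0_compat; nra.
Qed.

Section Zeros.

Variables w w1 w2 : R -> R.
Hypothesis Hosc : oscillating w w1 w2.

Lemma zeros_zero (k : nat) : 0 <= zeros w k /\ w (zeros w k) = 0.
Proof.
  induction k as [|k [H0 HZ]]; simpl.
  - split; [lra | apply Hosc].
  - destruct (next_zero_spec w w1 w2 (zeros w k) Hosc H0 HZ) as (Hlt & Hz & _).
    split; [lra | exact Hz].
Qed.

Lemma zeros_step (k : nat) :
  zeros w k < zeros w (S k) /\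
  forall x, zeros w k < x < zeros w (S k) -> w x <> 0.
Proof.
  destruct (zeros_zero k) as [H0 HZ].
  destruct (next_zero_spec w w1 w2 (zeros w k) Hosc H0 HZ) as (Hlt & _ & Hno).
  now split.
Qed.

Lemma zeros_pos (k : nat) : (1 <= k)%nat -> 0 < zeros w k.
Proof.
  destruct k as [|k]; [lia|]. intros _.
  destruct (zeros_zero k), (zeros_step k). lra.
Qed.

Lemma zeros_gap_below (k : nat) :
  4 <= (zeros w (S (S k)) - zeros w k) ^ 3 * zeros w (S (S k)).
Proof.
  destruct (zeros_zero k) as [H0 Z0], (zeros_zero (S k)) as [H1 Z1],
    (zeros_zero (S (S k))) as [H2 Z2].
  destruct (zeros_step k) as [S0 N0], (zeros_step (S k)) as [S1 N1].
  destruct Hosc as [Hw _].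
  apply (three_zeros w w1 w2 _ (zeros w (S k))); auto.
  exists ((zeros w k + zeros w (S k)) / 2). split; [lra|].
  apply N0. lra.
Qed.

Lemma zeros_gap_above (k : nat) :
  zeros w k * (zeros w (S k) - zeros w k) ^ 3 <= 128 ^ 3.
Proof.
  destruct (zeros_zero k), (zeros_step k).
  apply (gap_above w w1 w2); auto.
Qed.

(** The spacing of the zeros near [z] is of order [z^(-1/3)], so the powers
    [z^(4/3)] are spaced by amounts of order [1]. *)
Definition zeros43 (k : nat) : R := Rpower (zeros w k) (4 / 3).

(** Cube roots turn the fractional powers into polynomial arithmetic. *)
Lemma zeros43_root (k : nat) :
  (1 <= k)%nat ->
  exists r, 0 < r /\ zeros w k = r ^ 3 /\ zeros43 k = r ^ 4.
Proof.
  intros Hk. assert (Hz := zeros_pos k Hk).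
  exists (Rpower (zeros w k) (/ 3)).
  unfold zeros43.
  rewrite <- !Rpower_pow, !Rpower_mult by apply exp_pos.
  split; [apply exp_pos|]. split.
  - replace (/ 3 * INR 3) with 1 by (simpl; field). now rewrite Rpower_1.
  - f_equal. simpl. field.
Qed.

Lemma zeros43_inv (k : nat) :
  (1 <= k)%nat -> zeros w k = Rpower (zeros43 k) (3 / 4).
Proof.
  intros Hk. unfold zeros43. rewrite Rpower_mult.
  replace (4 / 3 * (3 / 4)) with 1 by field.
  symmetry. apply Rpower_1. now apply zeros_pos.
Qed.

(** With [a^3 < b^3] the two zeros, [three_zeros] gives [(b^3 - a^3) b >= 1], and
    [b^4 - a^4] exceeds this by [a^3 (b - a)]. *)
Lemma zeros43_step_below (k : nat) :
  (1 <= k)%nat -> zeros43 k + 1 <= zeros43 (S (S k)).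
Proof.
  intros Hk.
  destruct (zeros43_root k Hk) as (a & Ha & Ea & ->).
  destruct (zeros43_root (S (S k))) as (b & Hb & Eb & ->); [lia|].
  assert (Hgap := zeros_gap_below k). rewrite Ea, Eb in Hgap.
  destruct (zeros_step k) as [S0 _], (zeros_step (S k)) as [S1 _].
  assert (Hab : a ^ 3 < b ^ 3) by lra.
  assert (Hab' : a < b).
  { apply Rnot_le_lt. intros H. apply (Rlt_not_le _ _ Hab). apply pow_incr; lra. }
  assert (H1 : 1 <= (b ^ 3 - a ^ 3) * b).
  { apply cube_le_reg; [|rewrite Rpow_mult_distr; lra].
    apply Rmult_le_pos; lra. }
  assert (0 <= a ^ 3 * (b - a)) by (apply Rmult_le_pos; [apply pow_le|]; lra).
  lra.
Qed.

Lemma zeros43_lower (k : nat) : (1 <= k)%nat -> (INR k - 2) / 2 <= zeros43 k.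
Proof.
  assert (Hpos : forall k, 0 < zeros43 k) by (intros; apply exp_pos).
  assert (H : forall k, (INR (S k) - 2) / 2 <= zeros43 (S k) /\
                        (INR (S (S k)) - 2) / 2 <= zeros43 (S (S k))).
  { clear k. induction k as [|k [IH1 IH2]].
    - assert (H1 := Hpos 1%nat). assert (H2 := Hpos 2%nat). simpl. lra.
    - split; [exact IH2|].
      assert (H := zeros43_step_below (S k)).
      rewrite !S_INR in *. apply Rle_trans with (zeros43 (S k) + 1); [lra|].
      apply H. lia. }
  destruct k as [|k]; [lia|]. intros _. apply H.
Qed.

(** With [D = b^3 - a^3] and [a >= 1], [gap_above] gives [D a <= 128], hence
    [b - a <= D <= 128], and [b^4 - a^4 <= D (a + b) = 2 D a + D (b - a)] is at
    most [2 * 128 + 128^2 = 16640]. *)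
Lemma zeros43_step_above (k : nat) :
  (1 <= k)%nat -> 1 <= zeros w k -> zeros43 (S k) <= zeros43 k + 16640.
Proof.
  intros Hk H1.
  destruct (zeros43_root k Hk) as (a & Ha & Ea & ->).
  destruct (zeros43_root (S k)) as (b & Hb & Eb & ->); [lia|].
  assert (Hgap := zeros_gap_above k). rewrite Ea, Eb in Hgap. rewrite Ea in H1.
  destruct (zeros_step k) as [S0 _].
  assert (Ha1 : 1 <= a) by (apply cube_le_reg; lra).
  set (D := b ^ 3 - a ^ 3).
  assert (HD : 0 < D) by (unfold D; lra).
  assert (HDa : D * a <= 128).
  { apply cube_le_reg; [lra|]. rewrite Rpow_mult_distr. unfold D. lra. }
  assert (HD1 : D <= 128) by nra.
  assert (Hab : a < b).
  { apply Rnot_le_lt. intros H. apply (Rlt_not_le _ _ S0). rewrite Ea, Eb.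
    apply pow_incr; lra. }
  assert (Hdiff : b - a <= D).
  { replace D with ((b - a) * (b * b + a * b + a * a)) by (unfold D; ring).
    rewrite <- (Rmult_1_r (b - a)) at 1.
    apply Rmult_le_compat_l; nra. }
  assert (HDb : D * (b - a) <= 128 * 128) by (apply Rmult_le_compat; lra).
  assert (Hquart : b ^ 4 - a ^ 4 <= D * (a + b)).
  { replace (D * (a + b)) with (b ^ 4 - a ^ 4 + (b - a) * (a * b) * (b + a))
      by (unfold D; ring).
    assert (0 <= (b - a) * (a * b) * (b + a)); [|lra].
    repeat apply Rmult_le_pos; lra. }
  lra.
Qed.

Lemma zeros_unbounded : is_lim_seq (zeros w) p_infty.
Proof.
  apply is_lim_seq_spec. intros M. simpl.
  set (B := Rmax M 1).
  destruct (nfloor_ex (2 * Rpower B (4 / 3) + 2)) as [N HN].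
  { assert (H : 0 < Rpower B (4 / 3)) by apply exp_pos. lra. }
  exists (S N). intros k Hk.
  apply Rnot_le_lt. intros Hle.
  assert (Hk1 : (1 <= k)%nat) by lia.
  assert (Hlow := zeros43_lower k Hk1).
  assert (Hz := zeros_pos k Hk1).
  assert (HB : zeros43 k <= Rpower B (4 / 3)).
  { apply Rle_Rpower_l; [lra|]. split; [exact Hz|].
    apply Rle_trans with M; [exact Hle | apply Rmax_l]. }
  assert (HkN : INR N + 1 <= INR k) by (rewrite <- S_INR; now apply le_INR).
  lra.
Qed.

Lemma zeros_complete (z : R) :
  0 < z -> w z = 0 -> exists k, (1 <= k)%nat /\ z = zeros w k.
Proof.
  intros Hz Zz.
  destruct (proj2 (is_lim_seq_spec _ _) zeros_unbounded z) as [N HN].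
  specialize (HN N (Nat.le_refl N)).
  induction N as [|N IH]; [simpl in HN; lra|].
  destruct (Rlt_le_dec z (zeros w N)) as [Hlt|Hle]; [now apply IH|].
  exists N. destruct (zeros_step N) as [_ Hno].
  assert (Heq : z = zeros w N).
  { apply Rle_antisym; [|exact Hle].
    apply Rnot_lt_le. intros Hlt. now apply (Hno z). }
  split; [|exact Heq].
  destruct N; [simpl in Heq; lra | lia].
Qed.

Lemma zeros_growth :
  exists c1 c2 : R, 0 < c1 /\ c1 <= c2 /\
    eventually (fun k : nat =>
      c1 * Rpower (INR k) (3 / 4) <= zeros w k <= c2 * Rpower (INR k) (3 / 4)).
Proof.
  destruct (proj2 (is_lim_seq_spec _ _) zeros_unbounded 1) as [N HN].
  set (K := S N).
  assert (HK : forall k, (K <= k)%nat -> 1 <= zeros w k).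
  { intros k Hk. apply Rlt_le, HN. unfold K in Hk. lia. }
  set (C := zeros43 K + 16640).
  assert (HC0 : 16640 < C) by (unfold C; assert (H : 0 < zeros43 K) by apply exp_pos; lra).
  assert (Hup : forall j, zeros43 (j + K) <= zeros43 K + 16640 * INR j).
  { induction j as [|j IH]; [simpl; lra|].
    rewrite S_INR.
    assert (H := zeros43_step_above (j + K)). simpl (S j + K)%nat.
    apply Rle_trans with (zeros43 (j + K) + 16640); [|lra].
    apply H; [unfold K; lia | apply HK; lia]. }
  exists (Rpower (/ 4) (3 / 4)), (Rpower C (3 / 4)).
  split; [apply exp_pos|]. split; [apply Rle_Rpower_l; lra|].
  exists (K + 4)%nat. intros k Hk.
  assert (Hk4 : 4 <= INR k) by (replace 4 with (INR 4) by (simpl; lra); apply le_INR; lia).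
  rewrite !Rpower_mult_distr by lra.
  rewrite (zeros43_inv k) by lia.
  assert (Hlow := zeros43_lower k).
  assert (H43 : / 4 * INR k <= zeros43 k)
    by (apply Rle_trans with ((INR k - 2) / 2); [lra | apply Hlow; lia]).
  split; apply Rle_Rpower_l; try lra; split; try lra.
  specialize (Hup (k - K)%nat). rewrite Nat.sub_add in Hup by lia.
  rewrite minus_INR in Hup by lia.
  assert (H0 := pos_INR K).
  assert (HKp : 0 < zeros43 K) by apply exp_pos.
  assert (zeros43 K * 1 <= zeros43 K * INR k) by (apply Rmult_le_compat_l; lra).
  unfold C. lra.
Qed.

End Zeros.

(** * Eigenpairs and zeros of the Wronskian *)

Lemma sol3_smooth (s : R) (w w1 w2 : R -> R) :
  sol3 s everywhere w w1 w2 -> forall y : R,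
  differentiable_upto 3 w y /\ Derive_n w 3 y = s * (/ 4 * y * w y).
Proof.
  intros Hw.
  assert (E1 : forall y, Derive_n w 1 y = w1 y).
  { intros y. apply is_derive_unique, (Hw y I). }
  assert (E2 : forall y, Derive_n w 2 y = w2 y).
  { intros y. change (Derive (Derive_n w 1) y = w2 y).
    rewrite (Derive_ext _ w1) by exact E1. apply is_derive_unique, (Hw y I). }
  intros y. split.
  - intros j Hj. destruct j as [|[|[|[|j]]]]; [exact I | | | | lia].
    + exists (w1 y). apply (Hw y I).
    + apply (ex_derive_ext w1 (Derive_n w 1)); [intros; symmetry; apply E1|].
      exists (w2 y). apply (Hw y I).
    + apply (ex_derive_ext w2 (Derive_n w 2)); [intros; symmetry; apply E2|].
      eexists. apply (Hw y I).
  - change (Derive (Derive_n w 2) y = s * (/ 4 * y * w y)).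
    rewrite (Derive_ext _ w2) by exact E2. apply is_derive_unique, (Hw y I).
Qed.

Lemma derive_D_in (f : R -> R) (D : R -> Prop) (x0 l : R) :
  is_derive f x0 l -> D_in f (fun _ => l) D x0.
Proof.
  intros Hf. apply is_derive_Reals in Hf. intros eps Heps.
  destruct (Hf eps Heps) as [d Hd].
  exists d. split; [apply cond_pos|].
  intros x [[_ Hne] Hx]. simpl in *. unfold R_dist in *.
  assert (H := Hd (x - x0)). replace (x0 + (x - x0)) with x in H by ring.
  apply H; [lra | exact Hx].
Qed.

(** Transfers a one-sided boundary condition, imposed on a function known only
    inside the interval, to the two-sided derivative of the smooth function [P]
    that represents it there. *)
Lemma endpoint_match (phi P : R -> R) (a b x0 l : R) :
  a < b -> x0 = a \/ x0 = b ->
  (forall y, a < y < b -> phi y = P y) ->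
  D_in phi (fun _ => 0) (fun y => a <= y <= b) x0 ->
  is_derive P x0 l ->
  phi x0 = P x0 /\ l = 0.
Proof.
  intros Hab Hx0 Heq Hphi HP.
  set (D := fun y => a < y < b).
  assert (Hadh : adhDa D x0).
  { intros e He. destruct Hx0 as [->| ->].
    - exists (a + Rmin (e / 2) ((b - a) / 2)).
      assert (H1 := Rmin_l (e / 2) ((b - a) / 2)).
      assert (H2 := Rmin_r (e / 2) ((b - a) / 2)).
      assert (H3 : 0 < Rmin (e / 2) ((b - a) / 2)) by (apply Rmin_glb_lt; lra).
      split; [unfold D; lra|]. unfold Rdist. rewrite Rabs_pos_eq; lra.
    - exists (b - Rmin (e / 2) ((b - a) / 2)).
      assert (H1 := Rmin_l (e / 2) ((b - a) / 2)).
      assert (H2 := Rmin_r (e / 2) ((b - a) / 2)).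
      assert (H3 : 0 < Rmin (e / 2) ((b - a) / 2)) by (apply Rmin_glb_lt; lra).
      split; [unfold D; lra|]. unfold Rdist. rewrite Rabs_left1; lra. }
  (* both limits are compared along the open interval, where phi and P agree *)
  assert (restr : forall f g L, (forall y, D y -> f y = g y) ->
    limit1_in f (D_x (fun y => a <= y <= b) x0) L x0 -> limit1_in g D L x0).
  { intros f g L Hfg Hlim eps Heps. destruct (Hlim eps Heps) as [d [Hd H]].
    exists d. split; [exact Hd|]. intros x [Dx Hx]. rewrite <- (Hfg x Dx).
    apply H. split; [|exact Hx]. unfold D in Dx. split; [lra|].
    destruct Hx0; lra. }
  assert (HPD := derive_D_in P (fun y => a <= y <= b) x0 l HP).
  assert (Hval : phi x0 = P x0).
  { apply (single_limit P D _ _ x0 Hadh).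
    - apply (restr phi P); [exact Heq|]. exact (cont_deriv _ _ _ _ Hphi).
    - apply (restr P P); [reflexivity|]. exact (cont_deriv _ _ _ _ HPD). }
  split; [exact Hval|].
  apply (single_limit (fun x => (P x - P x0) / (x - x0)) D _ _ x0 Hadh).
  - apply (restr (fun x => (P x - P x0) / (x - x0))); [reflexivity|]. exact HPD.
  - apply (restr (fun x => (phi x - phi x0) / (x - x0))); [|exact Hphi].
    intros y Hy. rewrite Heq, Hval by exact Hy. reflexivity.
Qed.

Section Eigen.

Variables u u1 u2 t t1 t2 v v1 v2 : R -> R.
Hypothesis Hu : sol3 1 everywhere u u1 u2.
Hypothesis Ht : sol3 1 everywhere t t1 t2.
Hypothesis Hv : sol3 1 everywhere v v1 v2.
Hypotheses (u_0 : u 0 = 1) (u1_0 : u1 0 = 0) (u2_0 : u2 0 = 0).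
Hypotheses (t_0 : t 0 = 0) (t1_0 : t1 0 = 1) (t2_0 : t2 0 = 0).
Hypotheses (v_0 : v 0 = 0) (v1_0 : v1 0 = 0) (v2_0 : v2 0 = 1).
Hypothesis v_lower : forall y, 0 <= y -> / 2 * y ^ 2 <= v y.

Let W (y : R) : R := u y * v1 y - u1 y * v y.

(** Cramer's rule: the coefficients are Wronskians, constant by [wr3_const], and
    the basis has determinant [1].  No uniqueness theorem for the initial value
    problem is involved, so [D] may be an open interval at whose endpoints
    nothing is known about [w]. *)
Lemma general_solution (D : R -> Prop) (w w1 w2 : R -> R) (x0 : R) :
  convex D -> D x0 -> sol3 1 D w w1 w2 ->
  exists al be ga : R, forall y, D y -> w y = al * u y + be * t y + ga * v y.
Proof.
  intros HD H0 Hw.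
  assert (Hu' := sol3_restrict 1 _ D _ _ _ (fun _ _ => I) Hu).
  assert (Ht' := sol3_restrict 1 _ D _ _ _ (fun _ _ => I) Ht).
  assert (Hv' := sol3_restrict 1 _ D _ _ _ (fun _ _ => I) Hv).
  exists (wr3 w w1 w2 t t1 t2 v v1 v2 x0), (wr3 u u1 u2 w w1 w2 v v1 v2 x0),
    (wr3 u u1 u2 t t1 t2 w w1 w2 x0).
  intros y Hy.
  rewrite (wr3_const D w w1 w2 t t1 t2 v v1 v2 HD Hw Ht' Hv' x0 y H0 Hy).
  rewrite (wr3_const D u u1 u2 w w1 w2 v v1 v2 HD Hu' Hw Hv' x0 y H0 Hy).
  rewrite (wr3_const D u u1 u2 t t1 t2 w w1 w2 HD Hu' Ht' Hw x0 y H0 Hy).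
  assert (H1 : wr3 u u1 u2 t t1 t2 v v1 v2 y = 1).
  { rewrite (wr3_const everywhere u u1 u2 t t1 t2 v v1 v2
      (fun _ _ _ _ _ _ => I) Hu Ht Hv y 0 I I).
    unfold wr3. rewrite u_0, u1_0, u2_0, t_0, t1_0, t2_0, v_0, v1_0, v2_0. ring. }
  rewrite <- (Rmult_1_r (w y)), <- H1. unfold wr3. ring.
Qed.

Lemma v_pos (y : R) : 0 < y -> 0 < v y.
Proof.
  intros Hy. assert (H := v_lower y). assert (0 < y ^ 2) by now apply pow_lt. lra.
Qed.

Lemma wronskian_oscillating :
  oscillating W (fun y => u y * v2 y - u2 y * v y) (fun y => u1 y * v2 y - u2 y * v1 y).
Proof.
  split; [now apply wronskian_sol3|]. unfold W, energy.
  rewrite u_0, u1_0, u2_0, v_0, v1_0, v2_0. lra.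
Qed.

Lemma eigenpair_of_zero (z : R) :
  0 < z -> W z = 0 -> eigenpair z (fun y => u y - u z / v z * v y).
Proof.
  intros Hz HW. assert (Hvz := v_pos z Hz).
  assert (Hs := sol3_sub_scal 1 (u z / v z) everywhere _ _ _ _ _ _ Hu Hv).
  assert (Hsm := sol3_smooth _ _ _ _ Hs).
  split.
  - exact Hz.
  - intros y _. apply Hsm.
  - intros y _. rewrite (proj2 (Hsm y)). ring.
  - rewrite u_0, v_0. ring.
  - destruct (Hs 0 I) as [D0 _].
    apply derive_D_in. eapply derive_eq; [exact D0|].
    cbv beta. rewrite u1_0, v1_0. ring.
  - field. lra.
  - destruct (Hs z I) as [D0 _].
    apply derive_D_in. eapply derive_eq; [exact D0|].
    cbv beta. replace (u1 z - u z / v z * v1 z) with (- W z / v z)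
      by (unfold W; field; lra).
    rewrite HW. field. lra.
Qed.

(** Inside the interval the eigenfunction is a combination of the basis.  The two
    conditions at [0] fix the coefficients of [u] and [t]; the two at [z] then
    determine that of [v] and force the Wronskian to vanish. *)
Lemma eigenpair_inv (z : R) (phi : R -> R) :
  eigenpair z phi ->
  W z = 0 /\ forall y, 0 <= y <= z -> phi y = u y - u z / v z * v y.
Proof.
  intros [Hz Hdiff Heq H0 H0' H1 H1']. assert (Hvz := v_pos z Hz).
  set (D := fun y => 0 < y < z).
  assert (Hphi : sol3 1 D phi (Derive_n phi 1) (Derive_n phi 2)).
  { intros y Hy.
    assert (Hj : forall j, (j <= 2)%nat ->
              is_derive (Derive_n phi j) y (Derive_n phi (S j) y)).
    { intros j Hj. apply Derive_correct. apply (Hdiff y Hy (S j)). lia. }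
    split; [exact (Hj 0%nat ltac:(lia))|]. split; [exact (Hj 1%nat ltac:(lia))|].
    eapply derive_eq; [exact (Hj 2%nat ltac:(lia))|].
    specialize (Heq y Hy). lra. }
  destruct (general_solution D _ _ _ (z / 2) (convex_interval 0 z)
    ltac:(unfold D; lra) Hphi) as (al & be & ga & Hrep).
  set (P := fun y => al * u y + be * t y + ga * v y).
  assert (HP : forall y, is_derive P y (al * u1 y + be * t1 y + ga * v1 y)).
  { intros y. destruct (Hu y I) as [A _], (Ht y I) as [B _], (Hv y I) as [C _].
    unfold P. derive_poly. }
  destruct (endpoint_match phi P 0 z 0 _ Hz (or_introl eq_refl) Hrep H0' (HP 0))
    as [Hal Hbe].
  destruct (endpoint_match phi P 0 z z _ Hz (or_intror eq_refl) Hrep H1' (HP z))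
    as [HPz HPz'].
  unfold P in Hal, HPz. rewrite H0, u_0, t_0, v_0 in Hal. rewrite u1_0, t1_0, v1_0 in Hbe.
  assert (Eal : al = 1) by lra. assert (Ebe : be = 0) by lra. subst al be.
  rewrite H1 in HPz.
  assert (Ega : ga = - (u z / v z)).
  { apply Rmult_eq_reg_r with (v z); [|lra]. field_simplify; lra. }
  split.
  - assert (Eu : u z = - ga * v z) by lra.
    assert (Eu1 : u1 z = - ga * v1 z) by lra.
    unfold W. rewrite Eu, Eu1. ring.
  - intros y Hy.
    destruct (Req_dec y 0) as [->|N0]; [rewrite H0, u_0, v_0; ring|].
    destruct (Req_dec y z) as [->|Nz]; [rewrite H1; field; lra|].
    rewrite Hrep by (unfold D; lra). rewrite Ega. ring.
Qed.

(** The fourth-order equation is the derivative of [F''' - y F / 4 = 0]; evenness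
    gives [F'(0) = F'''(0) = 0], which fixes the constant of integration and
    removes the odd solution. *)
Lemma profile_combination (F : R -> R) :
  biharmonic_profile F -> exists be, forall y, F y = F 0 * u y + be * v y.
Proof.
  intros [Heven Hdiff Heq _].
  assert (Hj : forall j y, (j <= 3)%nat ->
            is_derive (Derive_n F j) y (Derive_n F (S j) y)).
  { intros j y Hj. apply Derive_correct. apply (Hdiff y (S j)). lia. }
  assert (Hodd : forall n, (n <= 4)%nat -> Derive_n F n 0 = (-1) ^ n * Derive_n F n 0).
  { intros n Hn.
    rewrite <- (Derive_n_ext _ _ n 0 Heven) at 1.
    rewrite Derive_n_comp_opp, Ropp_0; [reflexivity|].
    exists (mkposreal 1 Rlt_0_1). intros y _ k Hk. apply Hdiff. lia. }
  assert (F1_0 := Hodd 1%nat ltac:(lia)). assert (F3_0 := Hodd 3%nat ltac:(lia)).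
  assert (Hconst : forall y, Derive_n F 3 y - / 4 * y * F y = 0).
  { intros y.
    rewrite (const_of_derive0 everywhere (fun y => Derive_n F 3 y - / 4 * y * F y)
      (fun _ _ _ _ _ _ => I)) with (y := 0); try exact I.
    - lra.
    - intros x _. assert (D0 := Hj 0%nat x ltac:(lia)). assert (D3 := Hj 3%nat x ltac:(lia)).
      change (is_derive F x (Derive F x)) in D0.
      assert (E := Heq x). unfold opB in E.
      derive_poly. lra. }
  assert (HF : sol3 1 everywhere F (Derive_n F 1) (Derive_n F 2)).
  { intros y _. split; [exact (Hj 0%nat y ltac:(lia))|].
    split; [exact (Hj 1%nat y ltac:(lia))|].
    eapply derive_eq; [exact (Hj 2%nat y ltac:(lia))|].
    specialize (Hconst y). lra. }
  destruct (general_solution everywhere _ _ _ 0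
    (fun _ _ _ _ _ _ => I) I HF) as (al & be & ga & Hrep).
  assert (Hal : F 0 = al) by (rewrite Hrep, u_0, t_0, v_0 by exact I; ring).
  assert (Hbe : be = 0).
  { assert (D0 : is_derive F 0 be).
    { apply is_derive_ext with (fun y => al * u y + be * t y + ga * v y);
        [intros; symmetry; now apply Hrep|].
      destruct (Hu 0 I) as [A _], (Ht 0 I) as [B _], (Hv 0 I) as [C _].
      derive_poly. rewrite u1_0, t1_0, v1_0. ring. }
    apply is_derive_unique in D0. change (Derive_n F 1 0 = be) in D0. lra. }
  exists ga. intros y. rewrite Hrep, Hal, Hbe by exact I. ring.
Qed.

(** * Convergence to the profile *)

(** On [[T, z]] with [T = z - 1 >= 1] and [w = u - (u z / v z) v], the inequality
    [|w| <= 1 / 2 + w^2 / 2 <= 1 / 2 + 2 (y w^2 / 4)] bounds the integral of [|w|] by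
    [1 / 2 + 2 l], as the energy of [w] rises from [- l] to [0] over [[0, z]].  With
    [de] the defect [be + al l], this yields
    [|de| T^2 / 2 <= 1 + |al| / 2 + 2 |al| l], and [|al| l <= |de| + |be|]
    eliminates [l], which is not bounded beforehand. *)
Lemma defect_bound (F : R -> R) (al be z J : R) :
  (forall y, F y = al * u y + be * v y) ->
  2 <= z -> W z = 0 -> is_RInt F (z - 1) z J -> Rabs J <= 1 ->
  Rabs (be + al * (u z / v z)) * ((z - 1) ^ 2 / 2 - 2)
    <= 1 + Rabs al / 2 + 2 * Rabs be.
Proof.
  intros HF Hz HW HJ HJ1.
  assert (Hvz := v_pos z ltac:(lra)).
  set (l := u z / v z). set (de := be + al * l). set (T := z - 1).
  set (w := fun y => u y - l * v y).
  assert (Hw : sol3 1 everywhere w (fun y => u1 y - l * v1 y) (fun y => u2 y - l * v2 y))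
    by now apply sol3_sub_scal.
  set (E := energy w (fun y => u1 y - l * v1 y) (fun y => u2 y - l * v2 y)).
  assert (HE : forall y, is_derive E y (1 * (/ 4 * y * (w y * w y))))
    by (intros y; now apply (energy_derive 1 everywhere)).
  assert (HE0 : E 0 = - l).
  { unfold E, energy, w. rewrite u_0, u1_0, u2_0, v_0, v1_0, v2_0. field. }
  assert (HEz : E z = 0).
  { assert (Hwz : w z = 0) by (unfold w, l; field; lra).
    assert (Hw1z : u1 z - l * v1 z = 0).
    { replace (u1 z - l * v1 z) with (- W z / v z) by (unfold W, l; field; lra).
      rewrite HW. field. lra. }
    unfold E, energy. rewrite Hwz, Hw1z. ring. }
  assert (Hmono : forall x y, 0 <= x <= y -> E x <= E y).
  { intros x y Hxy.
    destruct (mean_value E _ x y (proj2 Hxy) (fun z _ => HE z)) as [c [Hc Ec]].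
    assert (0 <= c * (w c * w c) * (y - x)); [|lra].
    apply Rmult_le_pos; [apply Rmult_le_pos; [lra | apply Rle_0_sqr] | lra]. }
  assert (Hl : 0 <= l) by (assert (H := Hmono 0 z); lra).
  assert (HET : - l <= E T) by (rewrite <- HE0; apply Hmono; unfold T; lra).
  assert (Hsgn : exists e, e * de = Rabs de /\ Rabs e = 1).
  { destruct (Rle_dec 0 de).
    - exists 1. rewrite !Rabs_pos_eq; lra.
    - exists (-1). rewrite (Rabs_left de), Rabs_m1; lra. }
  destruct Hsgn as (e & Hede & He).
  set (A := Rabs al).
  assert (HA : 0 <= A) by apply Rabs_pos.
  assert (Hde : 0 <= Rabs de) by apply Rabs_pos.
  (* [G'] is a minorant of [e F] on [[T, z]] with the explicit primitive [G] *)
  set (G := fun y => (Rabs de * T ^ 2 / 2 - A / 2) * y - 2 * A * E y).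
  set (G' := fun y => Rabs de * T ^ 2 / 2 - A / 2 - 2 * A * (1 * (/ 4 * y * (w y * w y)))).
  assert (HGint : is_RInt G' T z (G z - G T)).
  { apply (is_RInt_derive G G').
    - intros y _. assert (D := HE y). unfold G, G'. derive_poly.
    - intros y _. apply (ex_derive_continuous G'). eexists.
      destruct (Hw y I) as [D _]. unfold G'. repeat derive_step. }
  assert (HeF : is_RInt (fun y => e * F y) T z (e * J))
    by exact (is_RInt_scal F T z e J HJ).
  assert (Hcmp : G z - G T <= e * J).
  { apply (is_RInt_le G' (fun y => e * F y) T z); auto; [unfold T; lra|].
    intros y Hy. unfold T in Hy.
    assert (HFy : e * F y = e * al * w y + Rabs de * v y).
    { rewrite HF, <- Hede. unfold w, de. ring. }
    assert (Hw1 : - (A * (/ 2 + / 2 * (w y * w y))) <= e * al * w y).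
    { assert (H1 : Rabs (e * al * w y) = A * Rabs (w y))
        by (rewrite !Rabs_mult, He; unfold A; ring).
      assert (H2 := Rle_abs (- (e * al * w y))). rewrite Rabs_Ropp, H1 in H2.
      assert (H3 : Rabs (w y) <= / 2 + / 2 * (w y * w y)).
      { assert (H4 := Rle_0_sqr (Rabs (w y) - 1)). unfold Rsqr in H4.
        assert (H5 : Rabs (w y) * Rabs (w y) = w y * w y)
          by (rewrite <- Rabs_mult; apply Rabs_pos_eq, Rle_0_sqr).
        lra. }
      assert (A * Rabs (w y) <= A * (/ 2 + / 2 * (w y * w y)))
        by now apply Rmult_le_compat_l.
      lra. }
    assert (Hyw : A * (w y * w y) * 1 <= A * (w y * w y) * y).
    { apply Rmult_le_compat_l; [|lra]. apply Rmult_le_pos; [exact HA | apply Rle_0_sqr]. }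
    assert (Hv1 : Rabs de * (/ 2 * T ^ 2) <= Rabs de * v y).
    { apply Rmult_le_compat_l; [exact Hde|].
      apply Rle_trans with (/ 2 * y ^ 2); [|apply v_lower; lra].
      apply Rmult_le_compat_l; [lra|]. apply pow_incr. unfold T. lra. }
    rewrite HFy. unfold G'. lra. }
  assert (HeJ : e * J <= 1).
  { apply Rle_trans with (Rabs (e * J)); [apply Rle_abs|].
    rewrite Rabs_mult, He. lra. }
  assert (HAl : A * l <= Rabs de + Rabs be).
  { replace (A * l) with (Rabs (de + - be)).
    - rewrite <- (Rabs_Ropp be). apply Rabs_triang.
    - unfold de. replace (be + al * l + - be) with (al * l) by ring.
      rewrite Rabs_mult, (Rabs_pos_eq l) by exact Hl. reflexivity. }
  assert (HGdiff : Rabs de * T ^ 2 / 2 - A / 2 - 2 * (A * l) <= G z - G T).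
  { unfold G. rewrite HEz.
    assert (A * - l <= A * E T) by now apply Rmult_le_compat_l.
    replace z with (T + 1) by (unfold T; ring). lra. }
  fold A. lra.
Qed.

End Eigen.

Lemma profile_integral (F : R -> R) :
  biharmonic_profile F ->
  exists M N, forall a b, a < M -> N < b ->
    exists J, is_RInt F a b J /\ Rabs (J - 1) < / 2.
Proof.
  intros [_ _ _ Hmass].
  destruct (Hmass (ball 1 (/ 2))) as [Q Q' [M HM] [N HN] Hball].
  { exists (mkposreal (/ 2) ltac:(lra)). intros y Hy. exact Hy. }
  exists M, N. intros a b Ha Hb.
  exact (Hball a b (HM a Ha) (HN b Hb)).
Qed.

Lemma profile_tail (F : R -> R) :
  biharmonic_profile F ->
  exists N, forall a b, N < a -> N < b -> exists J, is_RInt F a b J /\ Rabs J <= 1.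
Proof.
  intros HF. destruct (profile_integral F HF) as (M & N & Hint).
  exists N. intros a b Ha Hb.
  destruct (Hint (M - 1) a) as (I1 & H1 & B1); [lra | exact Ha |].
  destruct (Hint (M - 1) b) as (I2 & H2 & B2); [lra | exact Hb |].
  apply is_RInt_swap in H1.
  exists (- I1 + I2). split; [exact (is_RInt_Chasles F _ _ _ _ _ H1 H2)|].
  apply Rabs_def2 in B1. apply Rabs_def2 in B2. apply Rabs_le. lra.
Qed.

Lemma profile_nonzero (F : R -> R) :
  biharmonic_profile F -> ~ (forall y, F y = 0).
Proof.
  intros HF H0. destruct (profile_integral F HF) as (M & N & Hint).
  destruct (Hint (M - 1) (N + 1)) as (J & HJ & B); [lra | lra |].
  assert (HJ0 : is_RInt F (M - 1) (N + 1) 0).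
  { apply (is_RInt_ext (fun _ => 0)); [intros; symmetry; apply H0|].
    assert (Hc : is_RInt (fun _ => 0) (M - 1) (N + 1) ((N + 1 - (M - 1)) * 0))
      by exact (is_RInt_const (M - 1) (N + 1) 0).
    now rewrite Rmult_0_r in Hc. }
  assert (EJ : J = 0)
    by now rewrite <- (is_RInt_unique _ _ _ _ HJ), <- (is_RInt_unique _ _ _ _ HJ0).
  rewrite EJ in B. apply Rabs_def2 in B. lra.
Qed.

Theorem proposition9p1 (F : R -> R) (HF : biharmonic_profile F) :
  exists (y0 : nat -> R) (psi : nat -> R -> R),
    (forall k : nat, (1 <= k)%nat -> eigenpair (y0 k) (psi k)) /\
    (forall k : nat, (1 <= k)%nat -> y0 k < y0 (S k)) /\
    (forall (z : R) (phi : R -> R), eigenpair z phi ->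
       exists k : nat, (1 <= k)%nat /\ z = y0 k /\
         forall y : R, 0 <= y <= z -> phi y = psi k y) /\
    (exists c1 c2 : R, 0 < c1 /\ c1 <= c2 /\
       eventually (fun k : nat =>
         c1 * Rpower (INR k) (3 / 4) <= y0 k
           <= c2 * Rpower (INR k) (3 / 4))) /\
    is_lim_seq y0 p_infty /\
    cvg_unif_on_compacts y0 psi (fun y : R => F y / F 0).
Proof.
  destruct (solution_exists 1 0 0) as (u & u1 & u2 & Hu & u_0 & u1_0 & u2_0 & _).
  destruct (solution_exists 0 1 0) as (t & t1 & t2 & Ht & t_0 & t1_0 & t2_0 & _).
  destruct (solution_exists 0 0 (/ 2)) as (v & v1 & v2 & Hv & v_0 & v1_0 & v2_0 & Hlow).
  rewrite Rmult_0_r in u2_0, t2_0. rewrite Rinv_r in v2_0 by lra.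
  assert (v_lower : forall y, 0 <= y -> / 2 * y ^ 2 <= v y) by (apply Hlow; lra).
  set (W := fun y => u y * v1 y - u1 y * v y).
  assert (Hosc := wronskian_oscillating u u1 u2 v v1 v2 Hu Hv u_0 u1_0 u2_0 v_0 v1_0 v2_0).
  fold W in Hosc.
  set (y0 := zeros W).
  set (slope := fun k => u (y0 k) / v (y0 k)).
  assert (Hpos : forall k, (1 <= k)%nat -> 0 < y0 k) by exact (zeros_pos _ _ _ Hosc).
  assert (Hzero : forall k, W (y0 k) = 0) by (intros k; apply (zeros_zero _ _ _ Hosc)).
  assert (Hlim : is_lim_seq y0 p_infty) by exact (zeros_unbounded _ _ _ Hosc).
  exists y0, (fun k y => u y - slope k * v y).
  split; [|split; [|split; [|split; [|split]]]].
  - intros k Hk. apply (eigenpair_of_zero u u1 u2 v v1 v2); auto. exact (Hzero k).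
  - intros k Hk. apply (zeros_step _ _ _ Hosc).
  - intros z phi Hphi.
    destruct (eigenpair_inv u u1 u2 t t1 t2 v v1 v2 Hu Ht Hv u_0 u1_0 u2_0
      t_0 t1_0 t2_0 v_0 v1_0 v2_0 v_lower z phi Hphi) as [HWz Hrep].
    destruct (zeros_complete _ _ _ Hosc z (eigen_pos _ _ Hphi) HWz) as (k & Hk & Ek).
    exists k. split; [exact Hk|]. split; [exact Ek|].
    unfold slope. fold y0 in Ek. rewrite <- Ek. exact Hrep.
  - exact (zeros_growth _ _ _ Hosc).
  - exact Hlim.
  - destruct (profile_combination u u1 u2 t t1 t2 v v1 v2 Hu Ht Hv u_0 u1_0 u2_0
      t_0 t1_0 t2_0 v_0 v1_0 v2_0 F HF) as [be Hrep].
    set (al := F 0) in *.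
    destruct (profile_tail F HF) as [N HN].
    assert (Hdefect : forall eps, 0 < eps ->
      eventually (fun k => Rabs (be + al * slope k) < eps)).
    { intros eps Heps.
      set (B := 1 + Rabs al / 2 + 2 * Rabs be).
      assert (HB : 0 < B).
      { unfold B. assert (H1 := Rabs_pos al). assert (H2 := Rabs_pos be). lra. }
      assert (HBe : 0 < B / eps) by now apply Rdiv_lt_0_compat.
      destruct (proj2 (is_lim_seq_spec _ _) Hlim (B / eps + Rabs N + 5)) as [K HK].
      exists K. intros k Hk. specialize (HK k Hk).
      assert (HNa := Rle_abs N). assert (HN0 := Rabs_pos N).
      destruct (HN (y0 k - 1) (y0 k)) as (J & HJ & HJ1); [lra | lra |].
      assert (Hd := defect_bound u u1 u2 v v1 v2 Hu Hv u_0 u1_0 u2_0 v_0 v1_0 v2_0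
        v_lower F al be (y0 k) J Hrep ltac:(lra) (Hzero k) HJ HJ1).
      fold (slope k) B in Hd.
      assert (HT : B / eps < (y0 k - 1) ^ 2 / 2 - 2) by nra.
      apply Rnot_le_lt. intros Hge.
      apply (Rlt_irrefl B).
      apply Rlt_le_trans with (eps * ((y0 k - 1) ^ 2 / 2 - 2)).
      - replace B with (eps * (B / eps)) at 1 by (field; lra).
        now apply Rmult_lt_compat_l.
      - eapply Rle_trans; [|exact Hd]. apply Rmult_le_compat_r; lra. }
    assert (Hal : al <> 0).
    { intros Hal. apply (profile_nonzero F HF). intros y.
      assert (Hbe : be = 0).
      { destruct (Req_dec be 0) as [|Hne]; [assumption | exfalso].
        destruct (Hdefect (Rabs be)) as [K HK]; [now apply Rabs_pos_lt|].
        specialize (HK K (Nat.le_refl K)). rewrite Hal, Rmult_0_l, Rplus_0_r in HK. lra. }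
      rewrite Hrep, Hal, Hbe. ring. }
    intros C HC HC0 eps Heps.
    destruct (compact_P1 C HC) as (m & M & HM).
    destruct (continuity_ab_maj v 0 (Rmax M 0)) as [x [Hx Hx0]];
      [apply Rmax_r | intros; apply (sol3_continuous _ _ _ _ Hv) |].
    assert (Hvx : 0 <= v x).
    { assert (H := v_lower x ltac:(lra)). assert (0 <= x ^ 2) by (apply pow_le; lra). lra. }
    assert (Habs : 0 < Rabs al) by now apply Rabs_pos_lt.
    destruct (Hdefect (eps * Rabs al / (v x + 1))) as [K1 HK1].
    { apply Rdiv_lt_0_compat; [|lra]. now apply Rmult_lt_0_compat. }
    destruct (proj2 (is_lim_seq_spec _ _) Hlim M) as [K2 HK2].
    exists (Nat.max K1 K2). intros k Hk y Hy.
    specialize (HK1 k ltac:(lia)). specialize (HK2 k ltac:(lia)). simpl in HK2.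
    assert (HyM := HM y Hy). assert (Hy0 := HC0 y Hy).
    split; [lra|].
    assert (Hvy : 0 <= v y <= v x).
    { assert (H := v_lower y Hy0). assert (0 <= y ^ 2) by now apply pow_le.
      split; [lra|]. apply Hx. assert (HMm := Rmax_l M 0). lra. }
    fold al. rewrite Hrep.
    replace (u y - slope k * v y - (al * u y + be * v y) / al)
      with (- ((be + al * slope k) * v y / al)) by (field; exact Hal).
    unfold Rdiv. rewrite Rabs_Ropp, !Rabs_mult, Rabs_inv, (Rabs_pos_eq (v y)) by lra.
    apply Rmult_lt_reg_r with (Rabs al); [exact Habs|].
    rewrite Rmult_assoc, Rinv_l, Rmult_1_r by lra.
    apply Rle_lt_trans with (Rabs (be + al * slope k) * (v x)).
    + apply Rmult_le_compat_l; [apply Rabs_pos | lra].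
    + apply (Rmult_lt_compat_r (v x + 1)) in HK1; [|lra].
      unfold Rdiv in HK1. rewrite Rmult_assoc, Rinv_l, Rmult_1_r in HK1 by lra.
      assert (H := Rabs_pos (be + al * slope k)). lra.
Qed.
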